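(* Let $m$ and $k$ be fixed. Then there is a polynomial-time algorithm that, given a matrix $A\in\mathbb{Z}^{m\times n}$ (with $n$ part of the input), decides whether $A$ has affine TU-dimension $k$.
   Context: A matrix is totally unimodular (TU) if each of its square submatrices has determinant in $\{0,\pm1\}$. A matrix $A\in\mathbb{Z}^{m\times n}$ admits a $k$-row affine TU decomposition if there exist $U\in\mathbb{Z}^{m\times k}$ and $W\in\{0,\pm1\}^{k\times n}$ such that the stacked matrix $\begin{bmatrix}\tilde A\\ W\end{bmatrix}$ is totally unimodular, where $\tilde A\in\mathbb{Z}^{m\times n}$ is the unique matrix with $A=\tilde A+UW$. The affine TU-dimension of $A$ is the minimum $k\ge 0$ such that $A$ admits a $k$-row affine TU decomposition. Integers in the input are encoded in binary, and polynomial time means polynomial in the encoding length of $A$. *)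

(* Defs.v *)
From HB Require Import structures.
From Stdlib Require Import BinNums.
From mathcomp Require Import all_boot all_order all_algebra.

Set Implicit Arguments.
Unset Strict Implicit.
Unset Printing Implicit Defensive.

Import GRing.Theory Num.Theory.

Section AffineTU.
Local Open Scope ring_scope.

(* The order-preserving maps [f] and [g] select the rows and the columns of a
   p x p submatrix. *)
Definition totally_unimodular (m n : nat) (A : 'M[int]_(m, n)) : Prop :=
  forall (p : nat) (f : 'I_p -> 'I_m) (g : 'I_p -> 'I_n),
    {homo f : i j / (i < j)%N} -> {homo g : i j / (i < j)%N} ->
    \det (mxsub f g A) \in [:: 0; 1; -1].

Definition has_affine_TU_decomposition (m n k : nat) (A : 'M[int]_(m, n)) :
    Prop :=
  exists (U : 'M[int]_(m, k)) (W : 'M[int]_(k, n)) (At : 'M[int]_(m, n)),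
    [/\ forall i j, W i j \in [:: 0; 1; -1],
        A = At + U *m W
      & totally_unimodular (col_mx At W)].

Definition affine_TU_dimension_is (m n : nat) (A : 'M[int]_(m, n)) (k : nat) :
    Prop :=
  has_affine_TU_decomposition k A /\
  forall j : nat, has_affine_TU_decomposition j A -> (k <= j)%N.

End AffineTU.

Inductive move := MoveLeft | Stay | MoveRight.

(* A two-way infinite tape: [tleft] lists the cells to the left of the head,
   nearest first, [tright] those to the right, nearest first; [None] is the
   blank, and all cells beyond the two lists are blank. *)
Record tape (S : Type) := Tape {
  tleft : seq (option S);
  thead : option S;
  tright : seq (option S)
}.

Definition tape_of_word (S : Type) (w : seq S) : tape S :=
  Tape [::] (ohead w) (map Some (behead w)).

Definition tape_write (S : Type) (a : option S) (t : tape S) : tape S :=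
  Tape (tleft t) a (tright t).

Definition tape_move (S : Type) (d : move) (t : tape S) : tape S :=
  match d with
  | MoveLeft =>
      Tape (behead (tleft t)) (head None (tleft t)) (thead t :: tright t)
  | Stay => t
  | MoveRight =>
      Tape (thead t :: tleft t) (head None (tright t)) (behead (tright t))
  end.

(* The tape alphabet consists of the blank, the input alphabet [Sigma] and the
   auxiliary symbols [tm_aux]. A state [q] with [tm_verdict q = Some b] is
   halting, accepting if [b] and rejecting otherwise. *)
Record turing_machine (Sigma : finType) := TuringMachine {
  tm_state : finType;
  tm_aux : finType;
  tm_tapes : nat;  (* number of work tapes, besides the input tape *)
  tm_start : tm_state;
  tm_verdict : tm_state -> option bool;
  tm_delta : tm_state -> {ffun 'I_tm_tapes.+1 -> option (Sigma + tm_aux)} ->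
    tm_state * {ffun 'I_tm_tapes.+1 -> option (Sigma + tm_aux) * move}
}.

Section Run.
Variables (Sigma : finType) (M : turing_machine Sigma).

Record config := Config {
  cfg_state : tm_state M;
  cfg_tapes : {ffun 'I_(tm_tapes M).+1 -> tape (Sigma + tm_aux M)}
}.

(* Tape 0 holds the input; the head is on its first letter. *)
Definition init_config (w : seq Sigma) : config :=
  Config (tm_start M)
    [ffun i => tape_of_word (if i == ord0 then map inl w else [::])].

Definition step (c : config) : config :=
  if tm_verdict (cfg_state c) is Some _ then c else
  let: (q, act) :=
    tm_delta (cfg_state c) [ffun i => thead (cfg_tapes c i)] in
  Config q
    [ffun i => tape_move (act i).2 (tape_write (act i).1 (cfg_tapes c i))].

(* As halting configurations are fixed by [step], this says that the run on [w]
   halts after at most [t] steps, and that it accepts if and only if [P]. *)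
Definition decides_within (w : seq Sigma) (t : nat) (P : Prop) : Prop :=
  exists b : bool,
    tm_verdict (cfg_state (iter t step (init_config w))) = Some b /\
    (b <-> P).

End Run.

Inductive symbol := Plus | Minus | Bit of bool | EndColumn.

Definition symbol_code (s : symbol) : option (bool + bool) :=
  match s with
  | Plus => Some (inl true)
  | Minus => Some (inl false)
  | Bit b => Some (inr b)
  | EndColumn => None
  end.

Definition symbol_decode (c : option (bool + bool)) : symbol :=
  match c with
  | Some (inl b) => if b then Plus else Minus
  | Some (inr b) => Bit b
  | None => EndColumn
  end.

Lemma symbol_codeK : cancel symbol_code symbol_decode.
Proof. by case. Qed.

HB.instance Definition _ := Finite.copy symbol (can_type symbol_codeK).

(* Least significant bit first, without leading zeros; 0 has no bits. *)
Fixpoint bits_of_pos (p : positive) : seq bool :=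
  match p with
  | xH => [:: true]
  | xO p' => false :: bits_of_pos p'
  | xI p' => true :: bits_of_pos p'
  end.

Definition bits_of_nat (n : nat) : seq bool :=
  if bin_of_nat n is Npos p then bits_of_pos p else [::].

(* The sign comes first and thus also separates consecutive entries. *)
Definition encode_int (z : int) : seq symbol :=
  (if (z < 0)%R then Minus else Plus) :: map Bit (bits_of_nat `|z|%N).

(* Column-major; [EndColumn] makes the number of columns readable even if m = 0. *)
Definition encode_matrix (m n : nat) (A : 'M[int]_(m, n)) : seq symbol :=
  flatten [seq rcons (flatten [seq encode_int (A i j) | i <- enum 'I_m])
                     EndColumn
          | j <- enum 'I_n].

(* Main.v *)
Require Import Defs.
From HB Require Import structures.
From mathcomp Require Import all_boot all_order all_algebra.
From mathcomp Require Import fingroup perm boolp zify.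

(* In a decomposition A = At + U *m W, the columns of [col_mx At W] have entries
   in {0, 1, -1}, so A has at most D = 3 ^ (m + k) distinct columns, a constant.
   Moreover, zero or repeated columns do not matter. A machine with one work
   tape first collects the distinct columns, rejecting if there are more than D.
   The work tape has m x (D + 1) tracks: cell p holds the p-th signed binary
   digits of all entries of the matrix B of collected columns.

   Whether a matrix B of constant size has affine TU-dimension k is then decided
   by a finite automaton that reads its digits, least significant first. There
   are only finitely many candidates for W and At. Splitting off the last digits
   of B = b + 2 B' and of U = u + 2 U' turns B = C + U *m W into
   B' = C' + U' *m W with 2 C' = C + u *m W - b, and C' obeys the same bound as C.
   So the set of the pairs (C, W) for which a suitable U is still required to
   exist is a finite state. *)

Set Implicit Arguments.
Unset Strict Implicit.
Unset Printing Implicit Defensive.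

Import Order.TTheory GRing.Theory Num.Theory.

(** * Signed binary digits of integers *)

Section SignedDigits.
Local Open Scope ring_scope.

Definition digit (s b : bool) : option bool := if b then Some s else None.

Definition digit_val (g : option bool) : int :=
  if g is Some s then if s then 1 else -1 else 0.

(** Every nonzero digit carries the sign of [z], so a reader starting with the least significant
    digit needs no separate sign. *)
Definition int_digit (z : int) (p : nat) : option bool :=
  digit (0 <= z) (odd (`|z|%N %/ 2 ^ p)).

Definition digits_val (s : seq (option bool)) : int :=
  foldr (fun g x => digit_val g + x *+ 2) 0 s.

Lemma digits_val_nat (s : bool) (L n : nat) : (n < 2 ^ L)%N ->
  digits_val [seq digit s (odd (n %/ 2 ^ p)) | p <- iota 0 L] =
  if s then n%:Z else - n%:Z.
Proof.
elim: L n => [|L IHL] n; first by rewrite expn0 ltnS leqn0 => /eqP ->; case: s.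
rewrite expnS => ltnL /=; rewrite -[1%N]addn0 iotaDl -map_comp.
rewrite (@eq_map _ _ _ (fun p => digit s (odd (n./2 %/ 2 ^ p)))); last first.
  by move=> p /=; rewrite add1n expnS divnMA divn2.
rewrite IHL ?divn1; last by lia.
by have := odd_double_half n; rewrite /digit; case: (s); case: (odd n) => /= Hn; lia.
Qed.

Lemma int_digitsK (L : nat) (z : int) : (`|z| < 2 ^ L)%N ->
  digits_val [seq int_digit z p | p <- iota 0 L] = z.
Proof. by move=> ltzL; rewrite digits_val_nat //; case: ifP => ?; lia. Qed.

Lemma int_digit_out (L p : nat) (z : int) :
  (`|z| < 2 ^ L)%N -> (L <= p)%N -> int_digit z p = None.
Proof.
move=> ltzL leLp; rewrite /int_digit divn_small //.
by apply: leq_trans ltzL _; rewrite leq_exp2l.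
Qed.

(** By [int_digitsK], the first [L] digits recover both integers; the machine compares entries in
    this way. *)
Lemma int_digit_inj (L : nat) (y z : int) :
  (`|y| < 2 ^ L)%N -> (`|z| < 2 ^ L)%N ->
  all (fun p => int_digit y p == int_digit z p) (iota 0 L) = (y == z).
Proof.
move=> ltyL ltzL; apply/allP/eqP => [eqyz | -> //].
rewrite -(int_digitsK ltyL) -(int_digitsK ltzL); congr digits_val.
by apply/eq_in_map => p /eqyz /eqP.
Qed.

Lemma nth_bits_of_nat (n p : nat) :
  nth false (bits_of_nat n) p = odd (n %/ 2 ^ p).
Proof.
rewrite /bits_of_nat -{2}[n]bin_of_natK.
case: (bin_of_nat n) => [|q] /=; first by rewrite nth_nil div0n.
elim: q p => [q IHq|q IHq|] [|p] /=; rewrite ?expn0 ?divn1 ?NatTrec.doubleE /=.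
- by rewrite odd_double.
- by rewrite expnS divnMA divn2 /= uphalf_double IHq.
- by rewrite odd_double.
- by rewrite expnS divnMA divn2 doubleK IHq.
- by [].
- by rewrite nth_nil divn_small // -[ltnLHS](expn0 2) ltn_exp2l.
Qed.

Lemma ltn_exp_size_bits (n : nat) : (n < 2 ^ size (bits_of_nat n))%N.
Proof.
rewrite /bits_of_nat -{1}[n]bin_of_natK.
case: (bin_of_nat n) => //= q.
by elim: q => [q IHq|q IHq|] //=; rewrite ?NatTrec.doubleE expnS; lia.
Qed.

End SignedDigits.

(** * Entries of totally unimodular matrices *)

Section UnimodularEntries.
Local Open Scope ring_scope.

Definition sign_digit (x : int) : option bool := digit (0 <= x) (x != 0).

Lemma sign_digitK (x : int) : x \in [:: 0; 1; -1] -> digit_val (sign_digit x) = x.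
Proof. by rewrite !inE => /or3P[] /eqP ->. Qed.

Lemma totally_unimodular_entry (m n : nat) (A : 'M[int]_(m, n)) i j :
  totally_unimodular A -> A i j \in [:: 0; 1; -1].
Proof.
move=> TU; have := TU 1%N (fun=> i) (fun=> j); rewrite det_mx11 mxE.
by apply=> a b; rewrite !ord1.
Qed.

End UnimodularEntries.

(** * Matrix properties recognized by finite automata *)

Section Recognizable.
Local Open Scope ring_scope.
Variables m n : nat.

Definition digits_mx (s : seq 'M[option bool]_(m, n)) : 'M[int]_(m, n) :=
  \matrix_(i, j) digits_val [seq (v : 'M_(m, n)) i j | v <- s].

Lemma digits_mx_cons v s :
  digits_mx (v :: s) = map_mx digit_val v + digits_mx s *+ 2.
Proof. by apply/matrixP => i j; rewrite !(mulmxnE, mxE). Qed.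

(** All digit strings are covered, also those that mix signs within an entry or end in zero digits,
    which permits induction on the string. *)
Definition recognizable (P : 'M[int]_(m, n) -> Prop) : Prop :=
  exists (Q : finType) (q0 : Q) (delta : Q -> 'M[option bool]_(m, n) -> Q)
    (final : Q -> bool),
    forall s, final (foldl delta q0 s) <-> P (digits_mx s).

Lemma recognizable_ext (P P' : 'M[int]_(m, n) -> Prop) :
  (forall X, P X <-> P' X) -> recognizable P -> recognizable P'.
Proof.
move=> eqP [Q [q0 [delta [final ok]]]].
by exists Q, q0, delta, final => s; rewrite ok.
Qed.

Lemma recognizable_not P : recognizable P -> recognizable (fun X => ~ P X).
Proof.
case=> Q [q0 [delta [final ok]]].
by exists Q, q0, delta, (fun q => ~~ final q) => s; rewrite -ok; split=> /negP.
Qed.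

Lemma recognizable_and P P' :
  recognizable P -> recognizable P' -> recognizable (fun X => P X /\ P' X).
Proof.
case=> Q [q0 [delta [final ok]]] [Q' [q0' [delta' [final' ok']]]].
exists (Q * Q')%type, (q0, q0'), (fun q v => (delta q.1 v, delta' q.2 v)).
exists (fun q => final q.1 && final' q.2) => s; rewrite -ok -ok'.
have -> : foldl (fun q v => (delta q.1 v, delta' q.2 v)) (q0, q0') s =
          (foldl delta q0 s, foldl delta' q0' s).
  by elim: s (q0) (q0') => //= v s IHs q q'; rewrite IHs.
by split=> /andP.
Qed.

Lemma recognizable_forall_lt (P : nat -> 'M[int]_(m, n) -> Prop) (k : nat) :
  (forall j, recognizable (P j)) ->
  recognizable (fun X => forall j, (j < k)%N -> P j X).
Proof.
move=> recP; elim: k => [|k IHk].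
  by exists unit, tt, (fun _ _ => tt), (fun _ => true) => s; split.
apply: recognizable_ext (recognizable_and IHk (recP k)) => X.
split=> [[ltP Pk] j | leP]; last by split=> [j ltjk|]; apply: leP; lia.
by rewrite ltnS leq_eqVlt => /orP[/eqP -> //|/ltP].
Qed.

(** * The automaton for the existence of a decomposition *)

Section Decomposition.
Variable k : nat.

(* A state of the automaton is a set of pairs [(C, W)], and the matrix with the
   remaining digits has to be of the form [C + U *m W] for one of them. *)
Let K := k.+1.
Let carry := 'M['I_K.*2.+1]_(m, n).
Let carry_mx (C : carry) : 'M[int]_(m, n) :=
  map_mx (fun c : 'I_K.*2.+1 => c%:Z - K%:Z) C.
Let sign_mx (W : 'M[option bool]_(k, n)) : 'M[int]_(k, n) := map_mx digit_val W.
Let matches (X : 'M[int]_(m, n)) (x : carry * 'M[option bool]_(k, n)) : Prop :=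
  exists U : 'M[int]_(m, k), X = carry_mx x.1 + U *m sign_mx x.2.

Let carry_mx_onto (R : 'M[int]_(m, n)) :
  (forall i j, `|R i j| <= K%:Z) -> exists C, R = carry_mx C.
Proof.
move=> leRK; exists (\matrix_(i, j) inord (absz (R i j + K%:Z))).
by apply/matrixP => i j; rewrite !mxE inordK; have := leRK i j; lia.
Qed.

Let state := {set carry * 'M[option bool]_(k, n)}.
Let start : state :=
  [set x | `[< totally_unimodular (col_mx (carry_mx x.1) (sign_mx x.2)) >]].
Let next (S : state) (v : 'M[option bool]_(m, n)) :
    state :=
  [set y | `[< exists2 x, x \in S & x.2 = y.2 /\
     exists b : 'M[int]_(m, k), carry_mx y.1 *+ 2 =
       carry_mx x.1 + b *m sign_mx x.2 - map_mx digit_val v >]].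

Let abs_digit_val (g : option bool) : `|digit_val g| <= 1.
Proof. by case: g => [[]|]. Qed.

(** From right to left, [b + U *+ 2] is a suitable factor for any integer matrix [b]. From left to
    right, [b] is the remainder of [U] modulo 2 and the new carry has to be shown to stay
    bounded. *)
Let matches_next (S : state) v X :
  (exists2 x, x \in S & matches (map_mx digit_val v + X *+ 2) x) <->
  (exists2 y, y \in next S v & matches X y).
Proof.
split=> [[x Sx [U defU]] | [y]]; last first.
  rewrite inE => /asboolP[x Sx [eq_xy [b def_b]]] [U defX].
  exists x => //; exists (b + U *+ 2).
  rewrite defX mulrnDl def_b eq_xy mulmxDl [U *+ 2]mulr2n mulmxDl.
  by rewrite addrA [map_mx _ _ + _]addrC subrK mulr2n !addrA.
pose b := \matrix_(i, l) (U i l %% 2)%Z; pose U' := \matrix_(i, l) (U i l %/ 2)%Z.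
have defbU : U = b + U' *+ 2.
  apply/matrixP => i l; rewrite mulr2n !mxE {1}(divz_eq (U i l) 2); lia.
have def2R : (X - U' *m sign_mx x.2) *+ 2 =
    carry_mx x.1 + b *m sign_mx x.2 - map_mx digit_val v.
  have defX2 : X *+ 2 = carry_mx x.1 + U *m sign_mx x.2 - map_mx digit_val v.
    by rewrite -defU addrC addKr.
  rewrite mulrnBl defX2 defbU mulmxDl [U' *+ 2]mulr2n mulmxDl mulr2n.
  by rewrite addrAC [carry_mx _ + _]addrA addrK.
(* As [b] has entries 0 and 1, each entry [r] of the new carry satisfies [2 |r| <= K + k + 1 = 2 K];
   this dictates [K = k.+1]. *)
have [|C defC] := @carry_mx_onto (X - U' *m sign_mx x.2).
  move=> i j; move/matrixP/(_ i j): def2R; rewrite mulr2n.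
  move: (X - _) => R; rewrite !mxE.
  have : `|\sum_l b i l * sign_mx x.2 l j| <= k%:Z.
    apply: le_trans (ler_norm_sum _ _ _) _.
    have -> : k%:Z = \sum_(l < k) 1 by rewrite sumr_const card_ord natz.
    apply: ler_sum => l _.
    rewrite !mxE normrM; apply: mulr_ile1; rewrite ?abs_digit_val //; lia.
  have := abs_digit_val (v i j); have := ltn_ord (x.1 i j).
  move: (\sum_l _) (digit_val _) (R i j) (nat_of_ord _) => t d r c.
  rewrite /K; lia.
exists (C, x.2); last by exists U'; rewrite -defC subrK.
by rewrite inE; apply/asboolP; exists x; rewrite // -defC; split=> //; exists b.
Qed.

Lemma recognizable_decomposition :
  recognizable (has_affine_TU_decomposition k (n := n) (m := m)).
Proof.
exists state, start, next.
(* Once all digits are read, the remaining matrix is 0. Acceptance and transitions may be defined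
   classically, since they are finite tables. *)
exists (fun S : state => `[< exists2 x, x \in S & matches 0 x >]) => s.
have -> : `[< exists2 x, x \in foldl next start s & matches 0 x >] <->
    exists2 x, x \in start & matches (digits_mx s) x.
  elim: s (start) => [|v s IHs] S /=; last by rewrite IHs digits_mx_cons -matches_next.
  have -> : digits_mx [::] = 0 by apply/matrixP => i j; rewrite !mxE.
  by split=> /asboolP.
split=> [[x] | [U [W [At [Wsign defX TU]]]]].
  rewrite inE => /asboolP TU [U defX].
  exists U, (sign_mx x.2), (carry_mx x.1); split=> // i j.
  by rewrite mxE; case: (x.2 i j) => [[]|].
have [|C defC] := @carry_mx_onto At.
  move=> i j; have := totally_unimodular_entry (lshift k i) j TU.
  by rewrite col_mxEu !inE => /or3P[] /eqP ->.
have defW : W = sign_mx (map_mx sign_digit W).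
  by apply/matrixP => i j; rewrite !mxE sign_digitK.
exists (C, map_mx sign_digit W).
  by rewrite inE; apply/asboolP; rewrite -defC -defW.
by exists U; rewrite -defC -defW.
Qed.

End Decomposition.

(** Minimality excludes the finitely many [j < k], so it is a finite conjunction of complements. *)
Lemma recognizable_dimension (k : nat) :
  recognizable (fun X : 'M[int]_(m, n) => affine_TU_dimension_is X k).
Proof.
have rec_not j := recognizable_not (recognizable_decomposition j).
apply: recognizable_ext
  (recognizable_and (recognizable_decomposition k) (recognizable_forall_lt k rec_not)).
move=> X; split=> -[decX minX]; split=> // j; last by move=> ltjk /minX; lia.
by move=> decj; rewrite leqNgt; apply/negP => /minX.
Qed.

End Recognizable.

(** * Zero, repeated and permuted columns *)

Section ColumnSelection.
Local Open Scope ring_scope.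

Lemma injective_sort (p n : nat) (g : 'I_p -> 'I_n) : injective g ->
  exists s : {perm 'I_p}, {homo g \o s : i j / (i < j)%N}.
Proof.
(* The rank of [i] is the number of smaller values of [g]. It defines a permutation, whose inverse
   sorts [g]. *)
move=> inj_g; pose before i := [set j | (g j < g i)%N].
have lt_p i : (#|before i| < p)%N.
  rewrite -[ltnRHS]card_ord -cardsT proper_card // properT.
  by apply/eqP => /setP/(_ i); rewrite !inE ltnn.
pose rank i := Ordinal (lt_p i).
have lt_rank i j : (g i < g j)%N -> (rank i < rank j)%N.
  move=> ltij; apply/proper_card/properP; split; last first.
    by exists i; rewrite inE ?ltnn.
  by apply/subsetP => l; rewrite !inE => /ltn_trans; apply.
have inj_rank : injective rank.
  move=> i j eqij; apply: inj_g; apply: val_inj => /=.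
  by have [/lt_rank | /lt_rank |] // := ltngtP (g i) (g j); rewrite eqij ltnn.
exists (perm inj_rank)^-1%g => i j; rewrite /= => ltij.
have rankK l : rank ((perm inj_rank)^-1 l)%g = l.
  by rewrite -(permE inj_rank) permKV.
have [// | /lt_rank | /val_inj/inj_g/perm_inj eqij] := ltngtP.
  by rewrite !rankK ltnNge ltnW.
by rewrite eqij ltnn in ltij.
Qed.

(** Sorting the columns changes the determinant by a sign only. *)
Lemma totally_unimodular_inj (m n p : nat) (A : 'M[int]_(m, n))
    (f : 'I_p -> 'I_m) (g : 'I_p -> 'I_n) :
  totally_unimodular A -> {homo f : i j / (i < j)%N} -> injective g ->
  \det (mxsub f g A) \in [:: 0; 1; -1].
Proof.
move=> TU f_homo /injective_sort[s /(TU _ _ _ f_homo)].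
have -> : mxsub f (g \o s) A = col_perm s (mxsub f g A).
  by apply/matrixP => i j; rewrite !mxE.
rewrite col_permE det_mulmx det_perm; case: (odd_perm _); rewrite ?mulr1 //.
rewrite expr1 mulrN1 !inE.
by rewrite !eqr_oppLR oppr0 opprK => /or3P[] ->; rewrite ?orbT.
Qed.

(** A submatrix with a zero column or two equal columns has determinant 0; any other one selects
    columns of [A] injectively. *)
Lemma totally_unimodular_cols (m n n' : nat) (A : 'M[int]_(m, n))
    (h : 'I_n' -> option 'I_n) :
  totally_unimodular A ->
  totally_unimodular (\matrix_(i, j) if h j is Some d then A i d else 0).
Proof.
move=> TU p f g f_homo g_homo.
have [[j hgj] | noN] := pselect (exists j, h (g j) = None).
  rewrite (expand_det_col _ j) big1 // => i _.
  by rewrite !mxE hgj mul0r.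
have [inj_hg | ] := pselect (injective (h \o g)); last first.
  move=> /existsNP[i /existsNP[j /not_implyP[eqij neij]]].
  rewrite -det_tr (@determinant_alternate _ _ _ i j) //; first exact/eqP.
  by move=> l; rewrite !mxE; move: eqij => /= ->.
have e (j : 'I_p) : {d | h (g j) = Some d}.
  by case E: (h (g j)) => [d|]; [exists d | case: noN; exists j].
have -> : mxsub f g (\matrix_(i, j) if h j is Some d then A i d else 0) =
          mxsub f (fun j => sval (e j)) A.
  by apply/matrixP => i j; rewrite !mxE; case: (e j) => d /= ->.
apply: totally_unimodular_inj => // i j eqij; apply: inj_hg => /=.
by rewrite (svalP (e i)) (svalP (e j)) eqij.
Qed.

Definition column_or_zero (m n n' : nat) (A : 'M[int]_(m, n))
    (B : 'M[int]_(m, n')) : Prop :=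
  forall j, col j A = 0 \/ exists d, col j A = col d B.

(** The factor [U] is kept, while columns of [At] and [W] are copied or set to zero like those of
    [B]. *)
Lemma decomposition_columns (m n n' k : nat) (A : 'M[int]_(m, n))
    (B : 'M[int]_(m, n')) :
  column_or_zero A B ->
  has_affine_TU_decomposition k B -> has_affine_TU_decomposition k A.
Proof.
move=> AB [U [W [At [Wsign defB TU]]]].
have /choice[h hP] j : exists d : option 'I_n',
    col j A = if d is Some d then col d B else 0.
  by have [A0 | [d Ad]] := AB j; [exists None | exists (Some d)].
pose sel l (X : 'M[int]_(l, n')) : 'M[int]_(l, n) :=
  \matrix_(i, j) if h j is Some d then X i d else 0.
exists U, (sel _ W), (sel _ At); split.
- by move=> i j; rewrite mxE; case: (h j).
- apply/matrixP => i j; have /colP/(_ i) := hP j; rewrite mxE => ->.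
  case E: (h j) => [d|]; rewrite !mxE ?E.
    by rewrite defB !mxE; congr (_ + _); apply: eq_bigr => l _; rewrite mxE E.
  by rewrite add0r big1 // => l _; rewrite mxE E mulr0.
- have -> : col_mx (sel _ At) (sel _ W) = sel _ (col_mx At W).
    apply/matrixP => i j; rewrite [RHS]mxE; case: (split_ordP i) => l ->.
      by rewrite col_mxEu mxE; case: (h j) => // d; rewrite col_mxEu.
    by rewrite col_mxEd mxE; case: (h j) => // d; rewrite col_mxEd.
  exact: totally_unimodular_cols.
Qed.

Lemma dimension_columns (m n n' k : nat) (A : 'M[int]_(m, n))
    (B : 'M[int]_(m, n')) :
  column_or_zero A B -> column_or_zero B A ->
  affine_TU_dimension_is A k <-> affine_TU_dimension_is B k.
Proof.
move=> AB BA; split=> -[dec min]; split=> [|j decj].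
- exact: decomposition_columns dec.
- exact/min/(decomposition_columns AB).
- exact: decomposition_columns dec.
- exact/min/(decomposition_columns BA).
Qed.

(** With [U] fixed, a column of [A] is determined by the corresponding column of [col_mx At W],
    which is a sign vector of length [m + k]. *)
Lemma decomposition_few_columns (m n k D : nat) (A : 'M[int]_(m, n))
    (e : 'I_D -> 'I_n) :
  has_affine_TU_decomposition k A -> injective (fun d => col (e d) A) ->
  (D <= #|{: 'cV[option bool]_(m + k)}|)%N.
Proof.
move=> [U [W [At [_ defA TU]]]] inj_e.
pose code d : 'cV_(m + k) := map_mx sign_digit (col (e d) (col_mx At W)).
suff /leq_card : injective code by rewrite card_ord.
move=> d d' eq_code; apply: inj_e; rewrite defA !linearD /= ![col _ (U *m W)]colE.
rewrite -!mulmxA -!colE.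
have /eq_col_mx[-> ->] // : col_mx (col (e d) At) (col (e d) W) =
    col_mx (col (e d') At) (col (e d') W).
rewrite -!col_col_mx; apply/colP => i.
have codeE c : digit_val (code c i 0) = col_mx At W i (e c).
  by rewrite 2!mxE sign_digitK //; apply: totally_unimodular_entry.
by rewrite [LHS]mxE [RHS]mxE -!codeE eq_code.
Qed.

End ColumnSelection.

(** * Machines with a one-way input tape and one work tape *)

Section TwoTapes.
Variables (Sigma aux state : finType) (start : state).
Variable verdict : state -> option bool.
(* The result consists of the new state, whether the input head advances, and
   the letter written and the move made on the work tape. *)
Variable trans :
  state -> option Sigma -> option aux -> state * bool * (option aux * move).

Definition input_letter (a : option (Sigma + aux)) : option Sigma :=
  if a is Some (inl x) then Some x else None.

Definition work_letter (a : option (Sigma + aux)) : option aux :=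
  if a is Some (inr y) then Some y else None.

(** The input head never moves left, so the unread suffix of the input is all that a snapshot has to
    record of tape 0. *)
Definition two_tape_machine : turing_machine Sigma :=
  @TuringMachine Sigma state aux 1 start verdict (fun q a =>
    let: (q', adv, (y, d)) :=
      trans q (input_letter (a ord0)) (work_letter (a ord_max)) in
    (q', [ffun i => if i == ord0 then (a ord0, if adv then MoveRight else Stay)
                    else (omap inr y, d)])).

Record snapshot := Snapshot {
  snap_state : state;
  snap_input : seq Sigma;
  snap_work : nat -> option aux;
  snap_head : nat
}.

(* The work tape is only described from cell 0 on, which the machine never
   leaves to the left. *)
Definition represents (c : config two_tape_machine) (s : snapshot) : Prop :=
  [/\ cfg_state c = snap_state s,
      forall j, nth None (Defs.thead (cfg_tapes c ord0) :: tright (cfg_tapes c ord0)) j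
        = nth None (map (fun x => Some (inl x)) (snap_input s)) j,
      forall j,
        nth None (Defs.thead (cfg_tapes c ord_max) :: tright (cfg_tapes c ord_max)) j
        = omap inr (snap_work s (snap_head s + j))
    & forall j, j < snap_head s -> nth None (tleft (cfg_tapes c ord_max)) j
        = omap inr (snap_work s (snap_head s - j.+1))].

Definition reaches (n : nat) (s s' : snapshot) : Prop :=
  forall c, represents c s -> represents (iter n (@step _ _) c) s'.

Lemma reaches0 s : reaches 0 s s. Proof. by []. Qed.

Lemma reaches_trans s2 s1 s3 n1 n2 :
  reaches n1 s1 s2 -> reaches n2 s2 s3 -> reaches (n1 + n2) s1 s3.
Proof. by move=> r12 r23 c /r12 /r23; rewrite addnC iterD. Qed.

Lemma reaches_rcons s2 s1 s3 n :
  reaches n s1 s2 -> reaches 1 s2 s3 -> reaches n.+1 s1 s3.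
Proof. by rewrite -[n.+1]addn1; apply: reaches_trans. Qed.

Lemma reaches_cons s2 s1 s3 n :
  reaches 1 s1 s2 -> reaches n s2 s3 -> reaches n.+1 s1 s3.
Proof. by rewrite -[n.+1]add1n; apply: reaches_trans. Qed.

Definition move_head (d : move) (h : nat) : nat :=
  match d with MoveLeft => h.-1 | Stay => h | MoveRight => h.+1 end.

Lemma reaches_step q w f h q' adv y d w' f' h' :
  verdict q = None -> (d = MoveLeft -> 0 < h) ->
  trans q (ohead w) (f h) = (q', adv, (y, d)) ->
  w' = (if adv then behead w else w) ->
  (forall p, f' p = if p == h then y else f p) -> h' = move_head d h ->
  reaches 1 (Snapshot q w f h) (Snapshot q' w' f' h').
Proof.
move=> q_live h_gt0 eq_trans -> /funext -> -> c [/= cq c_in c_work c_left].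
have nth_head_behead (T : Type) (x : T) s j :
    nth x (head x s :: behead s) j = nth x s j.
  by case: s => [|a s] //=; case: j => [|j] //=; rewrite nth_nil.
have in0 : input_letter (Defs.thead (cfg_tapes c ord0)) = ohead w.
  by have /= -> := c_in 0; case: (w).
have work0 : work_letter (Defs.thead (cfg_tapes c ord_max)) = f h.
  by have /= -> := c_work 0; rewrite addn0; case: (f h).
have work_right j : nth None (tright (cfg_tapes c ord_max)) j =
    omap inr (f (h + j.+1)) by exact: c_work j.+1.
rewrite /represents /= /step /= cq q_live !ffunE in0 work0 eq_trans /=.
rewrite !ffunE /=; split=> //.
- move=> j; case: (adv) => /=; last exact: c_in.
  by rewrite nth_head_behead; have /= -> := c_in j.+1; case: (w) => //=; case: (j).
- case: d h_gt0 {eq_trans} => /= h_gt0 j.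
  + have {}h_gt0 := h_gt0 erefl.
    case: j => [|[|j]] /=.
    * rewrite addn0 ltn_eqF; last by lia.
      by rewrite -nth0 c_left // subn1.
    * by rewrite addn1 prednK // eqxx.
    * by rewrite work_right gtn_eqF; [do 2!congr (_ _)|]; lia.
  + case: j => [|j] /=; first by rewrite addn0 eqxx.
    by rewrite work_right gtn_eqF //; lia.
  + rewrite nth_head_behead work_right gtn_eqF; last by lia.
    by rewrite addSnnS.
- case: d h_gt0 {eq_trans} => /= h_gt0 j ltjh.
  + rewrite nth_behead c_left; last by lia.
    by rewrite ltn_eqF; [do 2!congr (_ _)|]; lia.
  + by rewrite c_left // ltn_eqF //; lia.
  + case: j ltjh => [|j] ltjh /=; first by rewrite subn1 eqxx.
    by rewrite c_left // subSS ltn_eqF //; lia.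
Qed.

Lemma reaches_step_id q w f h q' adv d w' h' :
  verdict q = None -> (d = MoveLeft -> 0 < h) ->
  trans q (ohead w) (f h) = (q', adv, (f h, d)) ->
  w' = (if adv then behead w else w) -> h' = move_head d h ->
  reaches 1 (Snapshot q w f h) (Snapshot q' w' f h').
Proof.
move=> q_live h_gt0 eq_trans eq_w eq_h; apply: reaches_step eq_trans _ _ _ => //.
by move=> p; case: eqP => // ->.
Qed.

(** The initial work cell gets number 1, so that the blank cell 0 can serve as left end marker. *)
Lemma represents_init w :
  represents (init_config two_tape_machine w) (Snapshot start w (fun=> None) 1).
Proof.
rewrite /represents /= !ffunE /=; split=> // -[|j] //=; rewrite ?nth_nil //.
  by case: w.
by case: w => [|x w] /=; rewrite ?nth_nil // -map_comp.
Qed.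

(** A halting configuration is a fixed point of [step], so a verdict obtained after [n] steps still
    stands after [t]. *)
Lemma decides_within_reaches w t n s b (P : Prop) :
  reaches n (Snapshot start w (fun=> None) 1) s -> n <= t ->
  verdict (snap_state s) = Some b -> (b <-> P) ->
  decides_within two_tape_machine w t P.
Proof.
move=> reach_s len_t s_halts bP; exists b; split=> //.
have [] := reach_s _ (represents_init w); set c := iter n _ _ => cq _ _ _.
have step_c : step c = c by rewrite /step /= cq s_halts.
rewrite -(subnK len_t) iterD -/c.
by rewrite (iter_fix _ step_c) cq.
Qed.

End TwoTapes.

(** * The machine and its run on a single column *)

Section Machine.
Variables (m D : nat) (Q : finType) (q0 : Q).
Variables (delta : Q -> 'M[option bool]_(m, D.+1) -> Q) (final : Q -> bool).

(* A scratch track [t] and, for each track [d], whether the entries read so far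
   of the current column agree with those on track [d]; the row comes first. *)
Definition context := ('I_m.+1 * 'I_D.+1 * {ffun 'I_D.+1 -> bool})%type.

Inductive control :=
  Entry of context | Scan of context & bool | Rewind of context
| Automaton of Q | Verdict of bool.

Definition control_code (q : control) : context + context * bool + context + Q + bool :=
  match q with
  | Entry x => inl (inl (inl (inl x)))
  | Scan x s => inl (inl (inl (inr (x, s))))
  | Rewind x => inl (inl (inr x))
  | Automaton q => inl (inr q)
  | Verdict b => inr b
  end.

Definition control_decode (c : context + context * bool + context + Q + bool) : control :=
  match c with
  | inl (inl (inl (inl x))) => Entry x
  | inl (inl (inl (inr (x, s)))) => Scan x s
  | inl (inl (inr x)) => Rewind x
  | inl (inr q) => Automaton q
  | inr b => Verdict b
  end.

Lemma control_codeK : cancel control_code control_decode.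
Proof. by case. Qed.

HB.instance Definition _ := Finite.copy control (can_type control_codeK).

(** The row is a natural number because the row counter lives in ['I_m.+1]; its last value [m]
    matches no row. *)
Definition put_entry (T : Type) (X : 'M[T]_(m, D.+1)) (r t : nat) (x : T) :
    'M[T]_(m, D.+1) :=
  \matrix_(i, d) if (i == r :> nat) && (d == t :> nat) then x else X i d.

Definition agree (T : eqType) (X : 'M[T]_(m, D.+1)) (r : nat) (x : T)
    (d : 'I_D.+1) : bool :=
  [forall i : 'I_m, (i == r :> nat) ==> (X i d == x)].

Definition is_bit (a : option symbol) : bool :=
  if a is Some (Bit _) then true else false.

Definition all_tracks : {ffun 'I_D.+1 -> bool} := [ffun=> true].

(** [Scan] writes an entry to row [r] of track [t] and compares it with all tracks, until both the
    bits and the nonblank cells are exhausted; [Rewind] returns to cell 1. At the end of a column,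
    [t] advances only if no other track holds the same column; otherwise the scratch track is
    reused. The end of the input starts the automaton. *)
Definition trans (q : control) (a : option symbol)
    (v : option 'M[option bool]_(m, D.+1)) :
    control * bool * (option 'M[option bool]_(m, D.+1) * move) :=
  match q with
  | Entry (r, t, eqs) =>
    match a with
    | Some Plus => (Scan (r, t, eqs) true, true, (v, Stay))
    | Some Minus => (Scan (r, t, eqs) false, true, (v, Stay))
    | Some EndColumn =>
      (if [exists d, (d != t) && eqs d] then Entry (ord0, t, all_tracks)
       else if t == ord_max then Verdict false
       else Entry (ord0, inord t.+1, all_tracks), true, (v, Stay))
    | Some (Bit _) => (Verdict false, true, (v, Stay))
    | None => (Automaton q0, false, (v, Stay))
    end
  | Scan (r, t, eqs) s =>
    if is_bit a || v then
      let x := if a is Some (Bit b) then digit s b else None in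
      let X := odflt (const_mx None) v in
      (Scan (r, t, [ffun d => eqs d && agree X r x d]) s, is_bit a,
       (Some (put_entry X r t x), MoveRight))
    else (Rewind (r, t, eqs), false, (v, MoveLeft))
  | Rewind (r, t, eqs) =>
    if v then (q, false, (v, MoveLeft))
    else (Entry (inord r.+1, t, eqs), false, (v, MoveRight))
  | Automaton q =>
    if v is Some X then (Automaton (delta q X), false, (v, MoveRight))
    else (Verdict (final q), false, (v, Stay))
  | Verdict _ => (q, false, (v, Stay))
  end.

Definition verdict (q : control) : option bool :=
  if q is Verdict b then Some b else None.

Definition machine : turing_machine symbol :=
  two_tape_machine (Entry (ord0, ord0, all_tracks)) verdict trans.

Local Notation reaches := (reaches (Entry (ord0, ord0, all_tracks)) verdict trans).

Definition bounded (B : 'M[int]_(m, D.+1)) (L : nat) : Prop :=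
  forall i d, `|B i d| < 2 ^ L.

Definition digit_mx (B : 'M[int]_(m, D.+1)) (p : nat) : 'M[option bool]_(m, D.+1) :=
  map_mx (int_digit^~ p) B.

(* Cell [p.+1] of the work tape holds the digits with index [p]. *)
Definition content (B : 'M[int]_(m, D.+1)) (L p : nat) :
    option 'M[option bool]_(m, D.+1) :=
  if 0 < p <= L then Some (digit_mx B p.-1) else None.

Lemma bounded_widen B L L' : L <= L' -> bounded B L -> bounded B L'.
Proof. by move=> leLL' ltBL i d; rewrite (leq_trans (ltBL i d)) ?leq_exp2l. Qed.

Lemma reaches_scan B L r t eqs (z : int) rest :
  bounded B L -> ~~ is_bit (ohead rest) ->
  let P := maxn L (size (bits_of_nat `|z|)) in
  reaches P (Snapshot (Scan (r, t, eqs) (0 <= z)%R)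
               (map Bit (bits_of_nat `|z|) ++ rest) (content B L) 1)
    (Snapshot (Scan (r, t, [ffun d => eqs d && agree B r z d]) (0 <= z)%R)
       rest (content (put_entry B r t z) P) P.+1).
Proof.
move=> ltBL rest_end P; set bits := bits_of_nat _; set B' := put_entry B r t z.
have ltzP : `|z| < 2 ^ P.
  by rewrite (leq_trans (ltn_exp_size_bits _)) // leq_exp2l // leq_maxr.
have ltBP : bounded B P by apply: bounded_widen ltBL; apply: leq_maxl.
(* Loop invariant: after [p] steps the first [p] digit cells are updated, and [flags p] records
   agreement on these digits. *)
pose mixed p q := if 0 < q <= maxn L p then
  Some (digit_mx (if q <= p then B' else B) q.-1) else None.
pose flags p := [ffun d => eqs d &&
  all (fun q => agree (digit_mx B q) r (int_digit z q) d) (iota 0 p)].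
have scan p : p <= P -> reaches p
    (Snapshot (Scan (r, t, eqs) (0 <= z)%R) (map Bit bits ++ rest) (content B L) 1)
    (Snapshot (Scan (r, t, flags p) (0 <= z)%R)
       (map Bit (drop p bits) ++ rest) (mixed p) p.+1).
  elim: p => [_|p IHp ltpP].
    have -> : flags 0 = eqs by apply/ffunP => d; rewrite ffunE andbT.
    have -> : mixed 0 = content B L.
      by apply/funext => q; rewrite /mixed /content maxn0; case: q.
    by rewrite drop0; apply: reaches0.
  apply: reaches_rcons (IHp (ltnW ltpP)) _.
  set a := ohead (map Bit (drop p bits) ++ rest).
  have eq_digit : (if a is Some (Bit b) then digit (0 <= z)%R b else None) =
      int_digit z p.
    rewrite /a; case: (ltnP p (size bits)) => [ltp | leq_p].
      by rewrite (drop_nth false) //= nth_bits_of_nat.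
    rewrite drop_oversize //= (int_digit_out (ltn_exp_size_bits _) leq_p).
    by case: (rest) rest_end => [|[] ].
  have eq_bit : is_bit a = (p < size bits).
    rewrite /a; case: (ltnP p (size bits)) => [ltp | leq_p].
      by rewrite (drop_nth false).
    by rewrite drop_oversize //=; apply: negbTE.
  have mixed_p : mixed p p.+1 = if p < L then Some (digit_mx B p) else None.
    by rewrite /mixed /= ltnn leq_max ltnn orbF.
  (* Reading a blank cell as zero digits is correct, since [B] has none but zero digits from index
     [L] on. *)
  have eq_old : odflt (const_mx None) (mixed p p.+1) = digit_mx B p.
    rewrite mixed_p; case: ltnP => //= leLp; apply/matrixP => i d.
    by rewrite !mxE (int_digit_out (ltBL i d)).
  have go_on : is_bit a || mixed p p.+1.
    rewrite eq_bit mixed_p; move: ltpP; rewrite /P leq_max orbC.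
    by case: (p < L); rewrite ?orbT ?orbF.
  apply: (@reaches_step _ _ _ _ _ _ _ _ _ _ _ (is_bit a)
    (Some (put_entry (digit_mx B p) r t (int_digit z p))) MoveRight) => //.
  - rewrite /= -/a go_on eq_digit eq_old; congr (Scan _ _, _, _); congr (_, _, _).
    have iotaSr : iota 0 p.+1 = iota 0 p ++ [:: p] by rewrite -addn1 iotaD.
    by apply/ffunP => d; rewrite !ffunE iotaSr all_cat /= andbT andbA.
  - rewrite eq_bit; case: ltnP => [ltp | leq_p]; first by rewrite (drop_nth false ltp).
    by rewrite !drop_oversize // ltnW.
  - move=> q; rewrite /mixed; case: eqP => [->|/eqP neqp] /=.
      rewrite leqnn leq_max leqnn orbT; congr Some; apply/matrixP => i d.
      by rewrite !mxE; case: ifP.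
    by rewrite !leq_max (leq_eqVlt q p.+1) (negbTE neqp) ltnS.
have := scan P (leqnn _); rewrite drop_oversize ?leq_maxr //=.
have -> : mixed P = content B' P.
  apply/funext => q; rewrite /mixed /content (maxn_idPr (leq_maxl _ _)).
  by case: (q <= P); rewrite ?andbF.
have -> // : flags P = [ffun d => eqs d && agree B r z d].
apply/ffunP => d; rewrite !ffunE; congr (_ && _).
(* Both [B i d] and [z] are below [2 ^ P] in absolute value, so agreement on [P] digits is
   equality. *)
apply/allP/forallP => [eq_dig i | eqz q _].
  apply/implyP => ir; rewrite -(int_digit_inj (ltBP i d) ltzP).
  by apply/allP => q /eq_dig /forallP/(_ i); rewrite ir mxE.
by apply/forallP => i; apply/implyP => ir; rewrite mxE; have := eqz i;
  rewrite ir => /eqP ->.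
Qed.

Lemma reaches_rewind (f : nat -> option 'M[option bool]_(m, D.+1))
    (x : context) w P :
  f 0 = None -> (forall p, p < P -> f p.+1) ->
  reaches P.+1 (Snapshot (Rewind x) w f P)
    (Snapshot (Entry (inord (x.1.1).+1, x.1.2, x.2)) w f 1).
Proof.
case: x => [[r t] eqs] /= f0.
elim: P => [_|P IHP fP].
  by apply: (@reaches_step_id _ _ _ _ _ _ _ _ _ _ _ false MoveRight) => //=; rewrite f0.
apply: reaches_cons; last by apply: IHP => p /ltnW/fP.
by apply: (@reaches_step_id _ _ _ _ _ _ _ _ _ _ _ false MoveLeft) => //=; rewrite fP.
Qed.

Lemma reaches_entry B L r t eqs (z : int) rest :
  bounded B L -> ~~ is_bit (ohead rest) ->
  let P := maxn L (size (bits_of_nat `|z|)) in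
  reaches (P.*2 + 3) (Snapshot (Entry (r, t, eqs)) (encode_int z ++ rest) (content B L) 1)
    (Snapshot (Entry (inord r.+1, t, [ffun d => eqs d && agree B r z d]))
       rest (content (put_entry B r t z) P) 1).
Proof.
move=> ltBL rest_end P; set eqs' := finfun _; set B' := put_entry _ _ _ _.
(* One step reads the sign, [P] steps scan, one turns around, and [P.+1] rewind to cell 0 and step
   back to cell 1. *)
have -> : P.*2 + 3 = (P + P.+2).+1 by lia.
apply: (reaches_cons (s2 := Snapshot (Scan (r, t, eqs) (0 <= z)%R)
  (map Bit (bits_of_nat `|z|) ++ rest) (content B L) 1)).
  apply: (@reaches_step_id _ _ _ _ _ _ _ _ _ _ _ true Stay) => //=.
  by rewrite /encode_int /= [(0 <= z)%R]leNgt; case: (z < 0)%R.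
apply: reaches_trans (reaches_scan (r := r) (t := t) (eqs := eqs) ltBL rest_end) _.
apply: reaches_cons; last first.
  apply: (@reaches_rewind (content B' P) (r, t, eqs') rest P) => // p ltpP.
  by rewrite /content ltpP.
apply: (@reaches_step_id _ _ _ _ _ _ _ _ _ _ _ false MoveLeft) => //=.
by rewrite (negbTE rest_end) /content ltnn.
Qed.

Definition encode_column (v : 'cV[int]_m) : seq symbol :=
  rcons (flatten [seq encode_int (v i ord0) | i <- enum 'I_m]) EndColumn.

Definition put_column (B : 'M[int]_(m, D.+1)) (t : 'I_D.+1) (v : 'cV[int]_m) :
    'M[int]_(m, D.+1) :=
  \matrix_(i, d) if d == t then v i ord0 else B i d.

Lemma col_put_column B t v d :
  col d (put_column B t v) = if d == t then v else col d B.
Proof. by apply/colP => i; rewrite !mxE; case: ifP => //; rewrite mxE. Qed.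

Lemma reaches_column N B L t (v : 'cV[int]_m) rest :
  L <= N -> bounded B L ->
  (forall i, size (bits_of_nat `|v i ord0|) <= N) ->
  exists n L', [/\ n <= m * (N.*2 + 3), L' <= N, bounded (put_column B t v) L' &
    reaches n
      (Snapshot (Entry (ord0, t, all_tracks)) (encode_column v ++ rest) (content B L) 1)
      (Snapshot (Entry (inord m, t, [ffun d => col d B == v])) (EndColumn :: rest)
        (content (put_column B t v) L') 1)].
Proof.
move=> leLN ltBL le_vN.
pose part r : 'M[int]_(m, D.+1) :=
  (\matrix_(i, d) if (i < r)%N && (d == t) then v i ord0 else B i d)%R.
(* The flags refer to the original [B] even on track [t], because row [r] is compared before it is
   overwritten. *)
pose eqs r := [ffun d => [forall i : 'I_m, (i < r) ==> (B i d == v i ord0)]].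
have : forall r, r <= m -> exists n L',
    [/\ n <= r * (N.*2 + 3), L' <= N, bounded (part r) L' & reaches n
      (Snapshot (Entry (ord0, t, all_tracks)) (encode_column v ++ rest) (content B L) 1)
      (Snapshot (Entry (inord r, t, eqs r))
        (flatten [seq encode_int (v i ord0) | i <- drop r (enum 'I_m)] ++ EndColumn :: rest)
        (content (part r) L') 1)].
  elim=> [_|r IHr ltrm].
    have -> : part 0 = B by apply/matrixP => i d; rewrite mxE.
    have -> : eqs 0 = all_tracks by apply/ffunP => d; rewrite !ffunE; apply/forallP.
    have -> : inord 0 = ord0 :> 'I_m.+1 by apply: val_inj; rewrite /= inordK.
    by exists 0, L; rewrite drop0 /encode_column cat_rcons; split.
  have [n [L' [le_n leL'N ltL']]] := IHr (ltnW ltrm).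
  have -> : drop r (enum 'I_m) = Ordinal ltrm :: drop r.+1 (enum 'I_m).
    rewrite (drop_nth (Ordinal ltrm)) ?size_enum_ord //; congr cons.
    by apply: val_inj; rewrite /= nth_enum_ord.
  set z := v (Ordinal ltrm) ord0; rewrite /= -/z -catA => reach_n.
  set P := maxn L' (size (bits_of_nat `|z|)).
  have lePN : P <= N by rewrite geq_max leL'N le_vN.
  have inord_r : (inord r : 'I_m.+1) = r :> nat by rewrite inordK // ltnW.
  have ltSr i : (i < r.+1) = (i == r) || (i < r) by rewrite ltnS leq_eqVlt.
  have eq_part : put_entry (part r) (inord r : 'I_m.+1) t z = part r.+1.
    apply/matrixP => i d; rewrite !mxE inord_r ltSr.
    case: eqP => [eq_ir | _] //=; rewrite ?eq_ir ?ltnn /=.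
    by rewrite (_ : i = Ordinal ltrm) //; apply: val_inj.
  have eq_eqs : [ffun d => eqs r d && agree (part r) (inord r : 'I_m.+1) z d] = eqs r.+1.
    apply/ffunP => d; rewrite !ffunE.
    apply/andP/forallP => [[/forallP eq_lt /forallP eq_r] i | eq_le].
      apply/implyP; rewrite ltSr => /orP[eq_ir | /(implyP (eq_lt i)) //].
      have := eq_r i; rewrite inord_r eq_ir mxE (eqP eq_ir) ltnn /= /z.
      by rewrite (_ : i = Ordinal ltrm) //; apply/val_inj/eqP.
    split; apply/forallP => i; apply/implyP.
      by move=> ltir; have := eq_le i; rewrite ltnS ltnW.
    rewrite inord_r mxE => eq_ir; rewrite (eqP eq_ir) ltnn /=.
    have := eq_le i; rewrite (eqP eq_ir) ltnSn /= /z.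
    by rewrite (_ : i = Ordinal ltrm) //; apply/val_inj/eqP.
  exists (n + (P.*2 + 3)), P; split=> //.
  - by rewrite mulSn; lia.
  - rewrite -eq_part => i d; rewrite mxE; case: ifP => _.
      by rewrite (leq_trans (ltn_exp_size_bits _)) // leq_exp2l // leq_maxr.
    by rewrite (leq_trans (ltL' i d)) // leq_exp2l // leq_maxl.
  apply: reaches_trans reach_n _.
  have -> : inord r.+1 = inord (inord r : 'I_m.+1).+1 :> 'I_m.+1 by rewrite inord_r.
  rewrite -eq_part -eq_eqs.
  apply: reaches_entry => //.
  by case: (drop _ _) => //= i s; rewrite /encode_int; case: ifP.
move/(_ m (leqnn m)) => [n [L' [le_n leL' ltL' reach_n]]]; exists n, L'.
have eq_part : part m = put_column B t v.
  by apply/matrixP => i d; rewrite !mxE ltn_ord.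
have eq_eqs : eqs m = [ffun d => col d B == v].
  apply/ffunP => d; rewrite !ffunE; apply/forallP/eqP => [eq_v | <- i].
    by apply/colP => i; have := eq_v i; rewrite ltn_ord mxE => /eqP.
  by rewrite mxE eqxx implybT.
by move: reach_n; rewrite drop_oversize ?size_enum_ord // -eq_part -eq_eqs; split.
Qed.

(** * Collecting the distinct columns *)

Lemma ord_ltn_eqF (i j : 'I_D.+1) : i < j -> (i == j) = false.
Proof. exact: ltn_eqF. Qed.

Lemma ord_gtn_eqF (i j : 'I_D.+1) : j < i -> (i == j) = false.
Proof. exact: gtn_eqF. Qed.

(* [B] stores the columns read so far on the tracks below [t], without
   repetitions and possibly without the zero column, which the unused tracks
   represent; track [t] may hold a repeated column. *)
Definition stores (done : seq 'cV[int]_m) (B : 'M[int]_(m, D.+1)) (t : nat) : Prop :=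
  [/\ forall d : 'I_D.+1, t < d -> col d B = 0%R,
      forall d, col d B = 0%R \/ col d B \in done,
      forall v, v \in done ->
        v = 0%R \/ exists2 d : 'I_D.+1, d < t & v = col d B,
      forall d : 'I_D.+1, d < t -> col d B \in done
    & forall d d' : 'I_D.+1, d < t -> d' < t -> col d B = col d' B -> d = d'].

(** If [d < t], then [v] is stored already; if [d > t], it is the zero column. Either way track [t]
    remains scratch. *)
Lemma stores_old done B (t d : 'I_D.+1) v :
  stores done B t -> d != t -> col d B = v -> stores (rcons done v) (put_column B t v) t.
Proof.
move=> [zero in_done is_stored below inj_below] neq_dt eq_v.
have other d' : d' != t -> col d' (put_column B t v) = col d' B.
  by move=> neq; rewrite col_put_column (negbTE neq).
split.
- by move=> d' lt_td'; rewrite other ?zero // ord_gtn_eqF.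
- move=> d'; rewrite col_put_column mem_rcons inE; case: eqP => [_ | _].
    by right; rewrite eqxx.
  by have [-> | ->] := in_done d'; [left | right; rewrite orbT].
- move=> u; rewrite mem_rcons inE => /orP[/eqP -> | /is_stored[-> | [d' ltd' ->]]].
  + have [ltdt | lttd | /val_inj eq_dt] := ltngtP d t.
    * by right; exists d; rewrite // other.
    * by left; rewrite -eq_v zero.
    * by rewrite eq_dt eqxx in neq_dt.
  + by left.
  + by right; exists d'; rewrite // other // ord_ltn_eqF.
- by move=> d' ltd'; rewrite other ?ord_ltn_eqF // mem_rcons inE below // orbT.
- by move=> d1 d2 lt1 lt2; rewrite !other ?ord_ltn_eqF //; apply: inj_below.
Qed.

Lemma stores_new done B (t : 'I_D.+1) v :
  stores done B t -> (forall d, d != t -> col d B <> v) ->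
  stores (rcons done v) (put_column B t v) t.+1.
Proof.
move=> [zero in_done is_stored below inj_below] new_v.
have other d' : d' != t -> col d' (put_column B t v) = col d' B.
  by move=> neq; rewrite col_put_column (negbTE neq).
have scratch : col t (put_column B t v) = v by rewrite col_put_column eqxx.
have leP (d : 'I_D.+1) : d < t.+1 -> d = t \/ d < t.
  by rewrite ltnS leq_eqVlt => /orP[/eqP/val_inj|]; [left | right].
split.
- by move=> d' lt_td'; rewrite other ?zero ?ord_gtn_eqF // ltnW.
- move=> d'; rewrite col_put_column mem_rcons inE; case: eqP => [_ | _].
    by right; rewrite eqxx.
  by have [-> | ->] := in_done d'; [left | right; rewrite orbT].
- move=> u; rewrite mem_rcons inE => /orP[/eqP -> | /is_stored[-> | [d' ltd' ->]]].
  + by right; exists t.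
  + by left.
  + by right; exists d'; rewrite ?other ?ord_ltn_eqF // ltnW.
- move=> d' /leP[-> | ltd']; first by rewrite scratch mem_rcons mem_head.
  by rewrite other ?ord_ltn_eqF // mem_rcons inE below // orbT.
- move=> d1 d2 /leP[-> | lt1] /leP[-> | lt2] //; rewrite ?scratch ?other ?ord_ltn_eqF //.
  + by move/esym/new_v; rewrite ord_ltn_eqF //; case.
  + by move/new_v; rewrite ord_ltn_eqF //; case.
  + exact: inj_below.
Qed.

(** * The automaton phase and the complete run *)

Lemma reaches_automaton q w B L (j : nat) : j <= L ->
  reaches (L - j).+1 (Snapshot (Automaton q) w (content B L) j.+1)
    (Snapshot (Verdict (final (foldl delta q [seq digit_mx B p | p <- iota j (L - j)])))
       w (content B L) L.+1).
Proof.
move=> lejL; move eq_i: (L - j) => i.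
elim: i j q lejL eq_i => [|i IHi] j q leqjL eq_i.
  have -> : j = L by lia.
  apply: (@reaches_step_id _ _ _ _ _ _ _ _ _ _ _ false Stay) => //=.
  by rewrite /content ltnn.
apply: reaches_cons; last by apply: IHi; lia.
apply: (@reaches_step_id _ _ _ _ _ _ _ _ _ _ _ false MoveRight) => //=.
by rewrite /content /= (_ : j < L) //; lia.
Qed.

Lemma digits_mxK B L : bounded B L ->
  digits_mx [seq digit_mx B p | p <- iota 0 L] = B.
Proof.
move=> ltBL; apply/matrixP => i d; rewrite mxE -map_comp -[RHS](int_digitsK (ltBL i d)).
by congr digits_val; apply: eq_map => p; rewrite /= mxE.
Qed.

(** Either the tracks overflow, and then they exhibit [D.+1] distinct columns, or the automaton
    decides [P] for a matrix that stores all columns. *)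
Lemma reaches_verdict (P : 'M[int]_(m, D.+1) -> Prop) N (cols : seq 'cV[int]_m)
    done B L (t : 'I_D.+1) :
  (forall s, final (foldl delta q0 s) <-> P (digits_mx s)) ->
  stores done B t -> bounded B L -> L <= N ->
  (forall v i, v \in cols -> size (bits_of_nat `|(v : 'cV_m) i ord0|) <= N) ->
  exists n b s', [/\ n <= size cols * (m * (N.*2 + 3) + 1) + N + 2,
    reaches n (Snapshot (Entry (ord0, t, all_tracks)) (flatten (map encode_column cols))
                 (content B L) 1) s',
    snap_state s' = Verdict b &
    (b = false /\ exists2 e : 'I_D.+1 -> 'cV[int]_m, injective e &
       forall d, e d \in done ++ cols) \/
    exists2 B' : 'M[int]_(m, D.+1), b <-> P B' &
      exists t', stores (done ++ cols) B' t'].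
Proof.
move=> finalP; elim: cols done B L t => [|v cols IH] done B L t.
  move=> storesB ltBL leLN _.
  (* One step starts the automaton, [L] steps read digits, and one gives the verdict. *)
  exists L.+2, (final (foldl delta q0 [seq digit_mx B p | p <- iota 0 L])).
  exists (Snapshot (Verdict (final (foldl delta q0 [seq digit_mx B p | p <- iota 0 L])))
            [::] (content B L) L.+1); split=> //; first by lia.
  - apply: (reaches_cons (s2 := Snapshot (Automaton q0) [::] (content B L) 1)).
      by apply: (@reaches_step_id _ _ _ _ _ _ _ _ _ _ _ false Stay).
    by have := @reaches_automaton q0 [::] B L 0 (leq0n L); rewrite subn0.
  - right; exists B; first by rewrite finalP digits_mxK.
    by exists t; rewrite cats0.
move=> storesB ltBL leLN le_N.
have [i|n1 [L' [le_n1 leL' ltL' reach_n1]]] :=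
    @reaches_column N B L t v (flatten (map encode_column cols)) leLN ltBL.
  by apply: le_N; rewrite mem_head.
have {}le_N u i : u \in cols -> size (bits_of_nat `|u i ord0|) <= N.
  by move=> u_cols; apply: le_N; rewrite inE u_cols orbT.
(* The continuation is shared by a repeated column, with [t' = t], and a new one that does not
   overflow, with [t' = t.+1]. *)
have next (t' : 'I_D.+1) : stores (rcons done v) (put_column B t v) t' ->
    trans (Entry (inord m, t, [ffun d => col d B == v])) (Some EndColumn)
      (content (put_column B t v) L' 1) =
    (Entry (ord0, t', all_tracks), true, (content (put_column B t v) L' 1, Stay)) ->
  exists n b s', [/\ n <= size (v :: cols) * (m * (N.*2 + 3) + 1) + N + 2,
    reaches n (Snapshot (Entry (ord0, t, all_tracks))
                 (flatten (map encode_column (v :: cols))) (content B L) 1) s',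
    snap_state s' = Verdict b &
    (b = false /\ exists2 e : 'I_D.+1 -> 'cV[int]_m, injective e &
       forall d, e d \in done ++ v :: cols) \/
    exists2 B' : 'M[int]_(m, D.+1), b <-> P B' &
      exists t', stores (done ++ v :: cols) B' t'].
  move=> stores' eq_trans.
  have [n [b [s' [le_n reach_n s'b res]]]] := IH _ _ _ _ stores' ltL' leL' le_N.
  exists (n1 + n.+1), b, s'; rewrite -cat_rcons; split=> //.
    by rewrite /= mulSn; move: le_n1 le_n; set x := m * _; set y := size cols * _; lia.
  apply: reaches_trans reach_n1 _; apply: reaches_cons reach_n.
  by apply: (@reaches_step_id _ _ _ _ _ _ _ _ _ _ _ true Stay).
case: (boolP [exists d, (d != t) && ([ffun d => col d B == v] d)]) => [old | new].
  have /existsP[d /andP[neq_dt]] := old; rewrite ffunE => /eqP eq_v.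
  by apply: (next t); [apply: stores_old eq_v | rewrite /= old].
have new_v d : d != t -> col d B <> v.
  move=> neq_dt /eqP eq_v; case/existsP: new; exists d.
  by rewrite ffunE neq_dt eq_v.
have stores' := stores_new storesB new_v.
have [eq_t | neq_t] := eqVneq t ord_max; last first.
  have ltt : t.+1 < D.+1.
    by rewrite ltn_neqAle ltn_ord andbT; apply: contra neq_t => /eqP[eq_t]; apply/eqP/val_inj.
  apply: (next (inord t.+1)); first by rewrite inordK.
  by rewrite /= (negbTE new) (negbTE neq_t).
exists n1.+1, false, (Snapshot (Verdict false) (flatten (map encode_column cols))
  (content (put_column B t v) L') 1); split=> //.
- by rewrite /= mulSn; move: le_n1; set x := m * _; set y := size cols * _; lia.
- apply: reaches_rcons reach_n1 _.
  apply: (@reaches_step_id _ _ _ _ _ _ _ _ _ _ _ true Stay) => //=.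
  by rewrite (negbTE new) eq_t eqxx.
- left; split=> //; case: stores' => _ _ _ in_done inj.
  have lt_t (d : 'I_D.+1) : d < t.+1 by rewrite eq_t.
  exists (fun d => col d (put_column B t v)) => [d d'|d]; first exact: inj.
  by rewrite -cat_rcons mem_cat in_done.
Qed.

End Machine.

(** * Encoding length and the polynomial bound *)

Lemma leq_size_flatten (T : eqType) (ss : seq (seq T)) s :
  s \in ss -> size s <= size (flatten ss).
Proof.
elim: ss => //= s' ss IHss; rewrite inE size_cat => /orP[/eqP -> | /IHss].
  exact: leq_addr.
by move/leq_trans; apply; apply: leq_addl.
Qed.

Lemma encode_matrixE (m n : nat) (A : 'M[int]_(m, n)) :
  encode_matrix A = flatten (map (@encode_column m) [seq col j A | j <- enum 'I_n]).
Proof.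
rewrite -map_comp; congr flatten; apply: eq_map => j; congr rcons.
by congr flatten; apply: eq_map => i; rewrite mxE.
Qed.

(** Each column contributes its [EndColumn], even if [m = 0]. *)
Lemma size_encode_matrix_cols (m n : nat) (A : 'M[int]_(m, n)) :
  n <= size (encode_matrix A).
Proof.
rewrite /encode_matrix -[leqLHS](size_enum_ord n).
elim: (enum 'I_n) => //= j s IHs; rewrite size_cat size_rcons.
by rewrite addSn ltnS (leq_trans IHs) // leq_addl.
Qed.

Lemma size_encode_matrix_bits (m n : nat) (A : 'M[int]_(m, n)) i j :
  size (bits_of_nat `|A i j|) <= size (encode_matrix A).
Proof.
have -> : size (bits_of_nat `|A i j|) = (size (encode_int (A i j))).-1.
  by rewrite /= size_map.
apply: leq_trans (leq_pred _) _.
apply: leq_trans (leq_size_flatten (map_f _ (mem_enum 'I_n j))).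
rewrite size_rcons; apply: leqW; apply: leq_size_flatten.
exact/map_f/mem_enum.
Qed.

Theorem theorem18 (m k : nat) :
  exists (M : turing_machine symbol) (p : {poly nat}),
    forall (n : nat) (A : 'M[int]_(m, n)),
      decides_within M (encode_matrix A) (p.[size (encode_matrix A)])%R
        (affine_TU_dimension_is A k).
Proof.
(* This is [3 ^ (m + k)], the number of sign vectors of length [m + k]. *)
pose D := #|{: 'cV[option bool]_(m + k)}|.
have [Q [q0 [delta [final finalP]]]] := @recognizable_dimension m D.+1 k.
exists (machine q0 delta final).
(* The bound of [reaches_verdict], with the encoding length in place of both [N] and the number of
   columns. *)
exists ('X * (m%:P * (2%N%:P * 'X + 3%N%:P) + 1%N%:P) + 'X + 2%N%:P)%R => n A.
set N := size (encode_matrix A); pose cols := [seq col j A | j <- enum 'I_n].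
have colsP v : reflect (exists j, v = col j A) (v \in cols).
  by apply: (iffP mapP) => [[j _ ->] | [j ->]]; exists j; rewrite ?mem_enum.
have start : stores [::] (0 : 'M[int]_(m, D.+1))%R (ord0 : 'I_D.+1).
  by split=> // d; rewrite col0 //; left.
have [||v i /colsP[j ->]|T [b [s [le_T reach_s s_b res]]]] :=
    @reaches_verdict m D Q q0 delta final
      (fun X => affine_TU_dimension_is X k) N cols [::] 0%R 0 ord0 finalP start.
- by move=> i d; rewrite mxE.
- by [].
- by rewrite mxE size_encode_matrix_bits.
have b_dim : b <-> affine_TU_dimension_is A k.
  case: res => [[-> [e inj_e e_cols]] | [B b_dim [t [_ B_cols cols_B _ _]]]].
    (* After an overflow, a decomposition would force [D.+1 <= D]. *)
    split=> // -[dec _].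
    have /choice[f fP] d : exists j, e d = col j A by exact/colsP/e_cols.
    have := @decomposition_few_columns m n k D.+1 A f dec.
    by rewrite ltnn => /(_ _)/notF[]; move=> d d' /=; rewrite -!fP => /inj_e.
  rewrite b_dim; apply: dimension_columns => j.
    by have [->|/colsP[d ->]] := B_cols j; [left | right; exists d].
  have /cols_B[->|[d _ ->]] : col j A \in cols by apply/colsP; exists j.
    by left.
  by right; exists d.
apply: (@decides_within_reaches _ _ _ _ _ _ _ _ T s b) => //; last by rewrite s_b.
  (* The blank work tape represents the zero matrix with [L = 0] digits. *)
  move: reach_s; rewrite -encode_matrixE.
  suff -> : content (0 : 'M[int]_(m, D.+1))%R 0 = fun=> None by [].
  by apply/funext => -[|p].
apply: leq_trans le_T _; rewrite !(hornerD, hornerM, hornerX, hornerC) size_map size_enum_ord.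
rewrite -[leqRHS]/(N * (m * (2 * N + 3) + 1) + N + 2) -mul2n.
by rewrite !leq_add2r leq_mul2r size_encode_matrix_cols orbT.
Qed.
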